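(* Let $G$ be a finite abelian group and let $H$ be a subgroup of $G$. Then $S(G) \subset S(H)$.
   Context: For a finite group $G$ and integers $x_g$ ($g \in G$), let $\Theta_G(x_g) := \det\left( x_{gh^{-1}} \right)_{g,h \in G}$ be the group determinant. Define $S(G) := \{ \Theta_G(x_g) \mid x_g \in \mathbb{Z} \text{ for all } g \in G \} \subset \mathbb{Z}$. *)

(* Defs.v *)
From mathcomp Require Import all_boot all_order all_algebra all_fingroup.

Set Implicit Arguments.
Unset Strict Implicit.
Unset Printing Implicit Defensive.

Import GRing.Theory.
Local Open Scope ring_scope.

(* Rows and columns are both indexed through the same enumeration of [G], so
   the determinant does not depend on it.  Only the values of [x] on [G] occur
   in the matrix. *)
Definition group_matrix (gT : finGroupType) (G : {group gT}) (x : gT -> int) :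
  'M[int]_#|G| :=
  \matrix_(i, j) x (enum_val i * (enum_val j)^-1)%g.

Definition group_det (gT : finGroupType) (G : {group gT}) (x : gT -> int) :
  int := \det (group_matrix G x).

Definition group_det_values (gT : finGroupType) (G : {group gT}) (n : int) :
  Prop := exists x : gT -> int, n = group_det G x.

(* Main.v *)
Require Import Defs.
From HB Require Import structures.
From mathcomp Require Import all_boot all_order all_algebra all_fingroup.

(** The group determinant of [G] at [x] is the norm from the group ring Z[G]
    to Z of the element with coefficients [x]: the group matrix is the matrix
    of multiplication by that element.  For a subgroup [H] of an abelian [G],
    Z[G] is a free module over the commutative ring Z[H], with basis a
    transversal of the cosets of [H], and the norm is transitive: the norm
    from Z[G] to Z is the norm from Z[G] to Z[H] followed by the norm from Z[H]
    to Z.  Every value of the group determinant of [G] is therefore the value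
    of the group determinant of [H] at an explicit element of Z[H].

    In terms of matrices, enumerate [G] as the products [a * t] of an element
    [a] of [H] and a coset representative [t].  As [G] is abelian, the entry
    [x (a * t * (b * u)^-1)] is [x (a * b^-1 * (t * u^-1))]: for fixed [t] and
    [u] it is a group matrix of [H].  The group matrix of [G] thus becomes a
    block matrix, whose blocks lie in the ring of group matrices of [H], a copy
    of Z[H] (the type [group_ring]).

    Transitivity of the norm is then [det_inflate]: if a commutative ring [R]
    acts by matrices through [phi], and [A] is a square matrix over [R], the
    block matrix with blocks [phi (A i j)] has determinant
    [\det (phi (\det A))].  Its proof is an induction on the size of [A].  One
    elimination step makes the first row of [A] zero outside its corner [a],
    and both sides of the identity are multiplicative, but the step multiplies
    them by a power of [\det (phi a)], which has to be cancelled and may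
    vanish.  So [a] is replaced by [a + t] for natural numbers [t]: both sides
    are polynomial in [t], and they agree whenever [\det (phi a + t)], a
    nonzero polynomial in [t], does not vanish ([det_eq_generic]). *)

Set Implicit Arguments.
Unset Strict Implicit.
Unset Printing Implicit Defensive.

Import Order.TTheory GRing.Theory Num.Theory.
Local Open Scope ring_scope.

(** * Determinants: reindexing and polynomial dependence on a parameter *)

Lemma det_castmx (R : comNzRingType) n p (e : (n = p) * (n = p))
    (A : 'M[R]_n) :
  \det (castmx e A) = \det A.
Proof.
by case: e => e1 e2; case: p / e1 e2 => e2; rewrite (eq_axiomK e2) castmx_id.
Qed.

Lemma det_mxsub_inj (R : comNzRingType) n p (f : 'I_n -> 'I_p) (A : 'M[R]_p) :
  n = p -> injective f -> \det (mxsub f f A) = \det A.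
Proof.
move=> enp; case: p / enp f A => f A f_inj.
have -> : mxsub f f A = row_perm (perm f_inj) (col_perm (perm f_inj) A).
  by apply/matrixP=> i j; rewrite !mxE !permE.
rewrite row_permE col_permE !det_mulmx !det_perm mulrCA odd_permV.
by rewrite -expr2 sqrr_sign mulr1.
Qed.

Definition det_pencil (S : comNzRingType) n (M N : 'M[S]_n) : {poly S} :=
  \det (map_mx polyC M + 'X *: map_mx polyC N).

Lemma horner_det_pencil (S : comNzRingType) n (M N : 'M[S]_n) t :
  (det_pencil M N).[t] = \det (M + t *: N).
Proof.
rewrite /det_pencil -horner_evalE -det_map_mx; congr (\det _).
by apply/matrixP=> i j; rewrite !mxE /= horner_evalE !hornerE.
Qed.

(** A density argument: the difference of the two pencils, multiplied by the
    characteristic polynomial of [- P], vanishes at every natural number, so it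
    is the zero polynomial, and the characteristic polynomial is monic.  The
    equality at [t = 0] thus holds even when [P] is singular. *)
Lemma det_eq_generic (S : numDomainType) m n p
    (P : 'M[S]_m) (M N : 'M[S]_n) (M' N' : 'M[S]_p) :
    (forall t : nat, \det (P + t%:R%:M) != 0 ->
       \det (M + t%:R *: N) = \det (M' + t%:R *: N')) ->
  \det M = \det M'.
Proof.
move=> eqD; suff eq_pencil : det_pencil M N = det_pencil M' N'.
  have := congr1 (horner^~ 0) eq_pencil.
  by rewrite !horner_det_pencil !scale0r !addr0.
pose q := char_poly (- P).
have qE (t : nat) : q.[t%:R] = \det (P + t%:R%:M).
  rewrite /q /char_poly -horner_evalE -det_map_mx; congr (\det _).
  apply/matrixP=> i j; rewrite !mxE /= horner_evalE !(hornerE, hornerMn).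
  by rewrite opprK addrC.
have q_neq0 : q != 0 by rewrite monic_neq0 ?char_poly_monic.
apply/eqP; rewrite -subr_eq0 -(mulIr_eq0 _ (mulIf q_neq0)); set d := _ * q.
apply/eqP/(@roots_geq_poly_eq0 _ _ [seq t%:R | t <- iota 0 (size d)]).
- apply/allP=> _ /mapP[t _ ->]; rewrite rootE hornerM hornerD hornerN.
  rewrite !horner_det_pencil qE.
  have [->|/eqD->] := eqVneq (\det (P + t%:R%:M)) 0; first by rewrite mulr0.
  by rewrite subrr mul0r.
- by rewrite map_inj_uniq ?iota_uniq //; apply: mulrIn; rewrite oner_neq0.
- by rewrite size_map size_iota.
Qed.

(** Only the top left entry of the matrix that multiplies [t] is nonzero, so
    the dependence on [t] is affine.  That is why the corner alone is shifted
    in [det_inflate]: the image of such a determinant under a ring morphism to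
    matrices is again of the form [M + t *: N]. *)
Lemma det_block_addl (R : comPzRingType) k (a t : R) b c (D : 'M[R]_k) :
  \det (block_mx (a + t)%:M b c D : 'M_(1 + k)) =
  \det (block_mx a%:M b c D : 'M_(1 + k)) + t * \det D.
Proof.
have Edet : \det (block_mx 1%:M 0 c D : 'M[R]_(1 + k)) = \det D.
  by rewrite det_lblock det1 mul1r.
have liftE (i : 'I_k) : lift (lshift k (0 : 'I_1)) i = rshift 1 i.
  exact: val_inj.
rewrite -Edet -[\det (block_mx a%:M _ _ _)]mul1r.
apply: (@determinant_multilinear _ _ _ _ _ (lshift k 0)).
- rewrite !rowKu; apply/rowP=> j; rewrite !mxE.
  by case: splitP => l _; rewrite !mxE ?ord1 /= ?mulr1 ?mulr0 ?mul1r ?addr0.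
- by apply/matrixP=> i j; rewrite [LHS]mxE [RHS]mxE liftE !col_mxEd.
- by apply/matrixP=> i j; rewrite [LHS]mxE [RHS]mxE liftE !col_mxEd.
Qed.

(** * Determinants of block matrices with blocks from a commutative ring *)

Definition inflate (R S : pzRingType) m (phi : R -> 'M[S]_m) k
    (A : 'M[R]_k) : 'M[S]_(\sum_(i < k) m) :=
  \mxblock_(i < k, j < k) phi (A i j).

Lemma inflateM (R S : pzRingType) m (phi : {rmorphism R -> 'M[S]_m}) k
    (A B : 'M[R]_k) :
  inflate phi (A *m B) = inflate phi A *m inflate phi B.
Proof.
rewrite mul_mxblock; apply: eq_mxblock => i j.
by rewrite mxE rmorph_sum; apply: eq_bigr => l _; rewrite rmorphM.
Qed.

Lemma inflateD (R S : pzRingType) m (phi : {rmorphism R -> 'M[S]_m}) k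
    (A B : 'M[R]_k) :
  inflate phi (A + B) = inflate phi A + inflate phi B.
Proof.
by rewrite -mxblockD; apply: eq_mxblock => i j; rewrite mxE rmorphD.
Qed.

Lemma inflateMn (R S : pzRingType) m (phi : {rmorphism R -> 'M[S]_m}) k
    (A : 'M[R]_k) t :
  inflate phi (A *+ t) = t%:R *: inflate phi A.
Proof.
elim: t => [|t IHt]; last by rewrite !mulrS inflateD IHt scalerDl scale1r.
rewrite mulr0n scale0r -mxblock0; apply: eq_mxblock => i j.
by rewrite mxE rmorph0.
Qed.

Lemma det_inflate_block (R : pzRingType) (S : comNzRingType) m
    (phi : {rmorphism R -> 'M[S]_m}) k a b c (D : 'M[R]_k) :
  \det (inflate phi (block_mx a%:M b c D : 'M[R]_(1 + k))) =
  \det (block_mx (phi a) (\mxrow_j phi (b 0 j)) (\mxcol_i phi (c i 0))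
                 (inflate phi D)).
Proof.
rewrite /inflate mxblock_recul det_castmx.
have lift0E (j : 'I_k) : lift ord0 j = rshift 1 j by apply: val_inj.
have ord0E : ord0 = lshift k (0 : 'I_1) by apply: val_inj.
congr (\det (block_mx _ _ _ _)).
- by rewrite [X in phi (_ X X)]ord0E block_mxEul mxE eqxx.
- by apply: eq_mxrow => j; rewrite lift0E ord0E block_mxEur.
- by apply: eq_mxcol => i; rewrite lift0E ord0E block_mxEdl.
- by apply: eq_mxblock => i j; rewrite !lift0E block_mxEdr.
Qed.

Lemma det_inflate_lblock (R : pzRingType) (S : comNzRingType) m
    (phi : {rmorphism R -> 'M[S]_m}) k a c (D : 'M[R]_k) :
  \det (inflate phi (block_mx a%:M 0 c D : 'M[R]_(1 + k))) =
  \det (phi a) * \det (inflate phi D).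
Proof.
rewrite det_inflate_block (_ : \mxrow_j _ = 0) ?det_lblock //.
by rewrite -mxrow0; apply: eq_mxrow => j; rewrite mxE rmorph0.
Qed.

Lemma det_inflate_ublock (R : pzRingType) (S : comNzRingType) m
    (phi : {rmorphism R -> 'M[S]_m}) k a b (D : 'M[R]_k) :
  \det (inflate phi (block_mx a%:M b 0 D : 'M[R]_(1 + k))) =
  \det (phi a) * \det (inflate phi D).
Proof.
rewrite det_inflate_block (_ : \mxcol_j _ = 0) ?det_ublock //.
by rewrite -mxcol0; apply: eq_mxcol => j; rewrite mxE rmorph0.
Qed.

(** This is transitivity of the norm: if [phi] is the action of [R] on a free
    module of rank [m] over [S], then the block matrix is the action of [A] on
    the sum of [k] copies of that module. *)
Lemma det_inflate (R : comPzRingType) (S : numDomainType) m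
    (phi : {rmorphism R -> 'M[S]_m}) k (A : 'M[R]_k) :
  \det (inflate phi A) = \det (phi (\det A)).
Proof.
elim: k A => [A|k IHk].
  rewrite [in RHS]det_mx00 rmorph1 det1.
  by move: (inflate _ _); rewrite big_ord0 => M; rewrite det_mx00.
rewrite -[k.+1]/(1 + k)%N => A0; rewrite -[A0]submxK [ulsubmx _]mx11_scalar.
move: (ulsubmx A0 0 0) (ursubmx A0) (dlsubmx A0) (drsubmx A0) => a b c D {A0}.
have nondeg a' : \det (phi a') != 0 ->
    \det (inflate phi (block_mx a'%:M b c D)) =
    \det (phi (\det (block_mx a'%:M b c D))).
  (* The column operation [U] clears [b] without inverting [a']; the induction
     hypothesis applies to the lower right blocks of both [U] and the product. *)
  move=> a'_neq0; pose U : 'M_(1 + k) := block_mx 1%:M (- b) 0 a'%:M.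
  have AU : block_mx a'%:M b c D *m U = block_mx a'%:M 0 c (a' *: D - c *m b).
    rewrite mulmx_block !mulmx1 !mulmx0 !addr0 !mulmxN.
    by rewrite mul_scalar_mx !mul_mx_scalar addNr addrC.
  have detU : \det (inflate phi U) = \det (phi (\det U)).
    by rewrite det_inflate_ublock IHk det_ublock det1 mul1r rmorph1 det1 mul1r.
  have detU_neq0 : \det (phi (\det U)) != 0.
    rewrite det_ublock det1 mul1r det_scalar.
    elim: (k) => [|l IHl]; first by rewrite expr0 rmorph1 det1 oner_neq0.
    by rewrite exprS rmorphM det_mulmx mulf_neq0.
  apply: (mulIf detU_neq0); rewrite -[in LHS]detU -!det_mulmx -inflateM.
  rewrite -[phi _ *m phi _]rmorphM -det_mulmx AU det_inflate_lblock IHk.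
  by rewrite -det_mulmx -[phi _ *m _]rmorphM det_lblock det_scalar1.
pose E : 'M[R]_(1 + k) := block_mx 1%:M 0 0 0.
have addE (t : nat) :
    block_mx a%:M b c D + E *+ t = block_mx (a + t%:R)%:M b c D.
  rewrite -scaler_nat scale_block_mx add_block_mx !scaler0 !addr0.
  by rewrite scale_scalar_mx mulr1 raddfD.
apply: (@det_eq_generic _ _ _ _ (phi a) _ (inflate phi E) _ (phi (\det D))).
move=> t; have phi_nat : phi t%:R = t%:R%:M.
  by rewrite rmorph_nat [RHS]raddfMn.
rewrite -phi_nat -rmorphD => /nondeg; rewrite -addE inflateD inflateMn => ->.
by rewrite addE det_block_addl rmorphD rmorphM phi_nat -mul_scalar_mx.
Qed.

(** * The ring of group matrices *)

Lemma group_matrix1 (gT : finGroupType) (H : {group gT}) :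
  1%:M = group_matrix H (fun h => (h == 1%g)%:R).
Proof.
by apply/matrixP=> i j; rewrite !mxE -eq_mulgV1 (inj_eq enum_val_inj).
Qed.

Lemma group_matrixB (gT : finGroupType) (H : {group gT}) (x y : gT -> int) :
  group_matrix H x - group_matrix H y = group_matrix H (fun h => x h - y h).
Proof. by apply/matrixP=> i j; rewrite !mxE. Qed.

Definition convolution (gT : finGroupType) (H : {group gT}) (x y : gT -> int)
    (g : gT) : int :=
  \sum_(h in H) x (g * h^-1)%g * y h.

Lemma group_matrixM (gT : finGroupType) (H : {group gT}) (x y : gT -> int) :
  group_matrix H x *m group_matrix H y = group_matrix H (convolution H x y).
Proof.
apply/matrixP=> i j; rewrite !mxE; under eq_bigr do rewrite !mxE.
rewrite -(big_enum_val
  (fun k => x (enum_val i * k^-1)%g * y (k * (enum_val j)^-1)%g)) /=.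
rewrite (reindex_inj (mulIg (enum_val j))) /=; apply: eq_big => h.
  by rewrite groupMr ?enum_valP.
by move=> _; rewrite invMg !mulgA mulgK.
Qed.

Lemma convolutionC (gT : finGroupType) (H : {group gT}) (x y : gT -> int) :
  abelian H -> {in H, convolution H x y =1 convolution H y x}.
Proof.
move=> cHH g Hg; rewrite /convolution (reindex_inj invg_inj).
rewrite (reindex_inj (mulgI g^-1%g)) /=; apply: eq_big => h.
  by rewrite groupV groupMl ?groupV.
rewrite groupV groupMl ?groupV // => Hh.
by rewrite invgK mulKVg mulrC invMg invgK (centsP cHH g) ?groupV.
Qed.

Lemma group_matrixC (gT : finGroupType) (H : {group gT}) (x y : gT -> int) :
  abelian H ->
  group_matrix H x *m group_matrix H y = group_matrix H y *m group_matrix H x.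
Proof.
move=> cHH; rewrite !group_matrixM; apply/matrixP=> i j; rewrite !mxE.
by apply: convolutionC => //; rewrite groupM ?groupV ?enum_valP.
Qed.

(** A group matrix is determined by its column at the identity of [H], which
    makes being one a decidable condition. *)
Definition is_group_matrix (gT : finGroupType) (H : {group gT}) :
    pred 'M[int]_#|H| :=
  fun M => M == group_matrix H (fun h =>
    M (enum_rank_in (group1 H) h) (enum_rank_in (group1 H) 1%g)).

Arguments is_group_matrix {gT} H _.

Lemma is_group_matrixP (gT : finGroupType) (H : {group gT})
    (M : 'M[int]_#|H|) :
  reflect (exists x : gT -> int, M = group_matrix H x)
          (M \in is_group_matrix H).
Proof.
apply: (iffP eqP) => [-> | [x ->]]; first by eexists.
apply/matrixP=> i j; rewrite !mxE.
by rewrite !enum_rankK_in ?groupM ?groupV ?enum_valP // invg1 mulg1.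
Qed.

Lemma is_group_matrix_subring (gT : finGroupType) (H : {group gT}) :
  subring_closed (is_group_matrix H).
Proof.
split.
- by apply/is_group_matrixP; eexists; exact: group_matrix1.
- move=> _ _ /is_group_matrixP[x ->] /is_group_matrixP[y ->].
  by apply/is_group_matrixP; eexists; exact: group_matrixB.
- move=> _ _ /is_group_matrixP[x ->] /is_group_matrixP[y ->].
  by apply/is_group_matrixP; eexists; exact: group_matrixM.
Qed.

(** The group ring Z[H] in its regular representation, so that its action by
    matrices is the subtype projection.  The proof of commutativity is a
    parameter of the type because the commutative ring instance is found from
    the type alone. *)
Definition group_ring (gT : finGroupType) (H : {group gT}) (cHH : abelian H) :=
  {M : 'M[int]_#|H| | is_group_matrix H M}.

HB.instance Definition _ (gT : finGroupType) (H : {group gT})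
    (cHH : abelian H) :=
  SubChoice.on (group_ring cHH).

HB.instance Definition _ (gT : finGroupType) (H : {group gT})
    (cHH : abelian H) :=
  GRing.SubChoice_isSubPzRing.Build 'M[int]_#|H| (is_group_matrix H)
    (group_ring cHH) (is_group_matrix_subring H).

Lemma group_ring_mulC (gT : finGroupType) (H : {group gT}) (cHH : abelian H) :
  commutative (@GRing.mul (group_ring cHH)).
Proof.
case=> M HM [N HN]; apply/val_inj; rewrite !rmorphM /=.
have /is_group_matrixP[x ->] := HM; have /is_group_matrixP[y ->] := HN.
exact: group_matrixC.
Qed.

HB.instance Definition _ (gT : finGroupType) (H : {group gT})
    (cHH : abelian H) :=
  GRing.PzRing_hasCommutativeMul.Build (group_ring cHH)
    (@group_ring_mulC gT H cHH).

Lemma group_matrix_is (gT : finGroupType) (H : {group gT}) (x : gT -> int) :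
  is_group_matrix H (group_matrix H x).
Proof. by apply/is_group_matrixP; exists x. Qed.

Definition group_ring_elt (gT : finGroupType) (H : {group gT})
    (cHH : abelian H) (x : gT -> int) : group_ring cHH :=
  exist _ (group_matrix H x) (group_matrix_is H x).

Lemma group_det_values_det (gT : finGroupType) (H : {group gT})
    (cHH : abelian H) (M : group_ring cHH) :
  group_det_values H (\det (val M)).
Proof. by have /is_group_matrixP[y ->] := valP M; exists y. Qed.

(** * Enumerating a group by the cosets of a subgroup *)

Definition rcoset_rep (gT : finGroupType) (G H : {group gT})
    (i : 'I_#|rcosets H G|) : gT :=
  repr (enum_val i).

(** Row indices of a block matrix with one block row per coset, read as group
    elements. *)
Definition coset_elt (gT : finGroupType) (G H : {group gT})
    (s : 'I_(\sum_(i < #|rcosets H G|) #|H|)) : gT :=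
  (enum_val (tagnat.sig2 s : 'I_#|H|) * rcoset_rep (tagnat.sig1 s))%g.

Lemma coset_elt_inj (gT : finGroupType) (G H : {group gT}) :
  injective (@coset_elt gT G H).
Proof.
have cosetE (i : 'I_#|rcosets H G|) (a : 'I_#|H|) :
    (H :* (enum_val a * rcoset_rep i))%g = enum_val i.
  rewrite rcosetM rcoset_id ?enum_valP // /rcoset_rep.
  by have /rcosetsP[g _ ->] := enum_valP i; rewrite rcoset_repr.
move=> s t; rewrite /coset_elt => eq_st.
have eq1 : tagnat.sig1 s = tagnat.sig1 t.
  by apply: enum_val_inj; rewrite -(cosetE _ (tagnat.sig2 s)) eq_st cosetE.
move: eq_st; rewrite eq1 => /mulIg/enum_val_inj eq2.
rewrite -[s]tagnat.sig2K -[t]tagnat.sig2K; apply: val_inj; apply/eqP.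
by rewrite tagnat.eq_Rank eq1 eq2 !eqxx.
Qed.

Lemma rcoset_rep_in (gT : finGroupType) (G H : {group gT}) :
  H \subset G -> forall i, @rcoset_rep gT G H i \in G.
Proof.
move=> sHG i; have /rcosetsP[g Gg] := enum_valP i; rewrite /rcoset_rep => ->.
by apply: (subsetP _ _ (mem_repr_rcoset H g)); rewrite mul_subG ?sub1set.
Qed.

Lemma coset_elt_in (gT : finGroupType) (G H : {group gT}) :
  H \subset G -> forall s, @coset_elt gT G H s \in G.
Proof.
move=> sHG s; apply: groupM; last exact: rcoset_rep_in.
by rewrite (subsetP sHG) ?enum_valP.
Qed.

(** * Group determinants of a subgroup *)

Theorem corollary1p3 (gT : finGroupType) (G H : {group gT}) :
  abelian G -> H \subset G ->
  forall n : int, group_det_values G n -> group_det_values H n.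
Proof.
move=> cGG sHG _ [x ->]; have cHH := abelianS sHG cGG.
(* The matrix over Z[H] of multiplication by [x] on the free module Z[G]. *)
pose A : 'M[group_ring cHH]_#|rcosets H G| := \matrix_(i, j)
  group_ring_elt cHH (fun h => x (h * (rcoset_rep i * (rcoset_rep j)^-1))%g).
suff -> : group_det G x = \det (val (\det A)) by apply: group_det_values_det.
rewrite -det_inflate.
pose f s := enum_rank_in (group1 G) (@coset_elt gT G H s).
rewrite /group_det -(@det_mxsub_inj _ _ _ f).
- congr (\det _); apply/matrixP=> r s.
  rewrite !mxE /f !enum_rankK_in ?coset_elt_in //=.
  rewrite /coset_elt invMg !mulgA -!(mulgA (enum_val _)); congr (x (_ * _)%g).
  rewrite (centsP cGG _ _ (enum_val _)^-1%g) ?groupM ?groupV ?rcoset_rep_in //.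
    by rewrite mulgA.
  by rewrite (subsetP sHG) ?enum_valP.
- by rewrite sum_nat_const card_ord mulnC -[RHS](Lagrange sHG).
- move=> r s /enum_rank_in_inj eq_rs; apply: coset_elt_inj.
  by apply: eq_rs; apply: coset_elt_in.
Qed.
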